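(* Let $Q_8$ be the quaternion group of order $8$ with its standard generators $x,y$, i.e. $Q_8=\langle x,y : x^4=e,\ y^2=x^2,\ y^{-1}xy=x^{-1}\rangle$. Then the period of the Pell-Narayana orbit of $Q_8$ for the generating pair $(x,y)$ is $LPN(Q_8)_{(x,y)}=6$.
   Context: For a finite group $G$ generated by a pair $(x_0,x_1)$, the Pell-Narayana orbit $PN(G)_{(x_0,x_1)}$ is the sequence $(s_n)_{n\ge 0}$ in $G$ given by $s_0=x_0$, $s_1=x_1$, $s_2=(s_1)^2$, and $s_n=s_{n-3}(s_{n-1})^2$ for $n\ge 3$. Its period, denoted $LPN(G)_{(x_0,x_1)}$, is the least integer $k\ge 1$ such that $s_{n+k}=s_n$ for all $n\ge 0$. The identity element is denoted $e$. *)

(* Defs.v *)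
From HB Require Import structures.
From mathcomp Require Import all_boot all_fingroup all_solvable.

Set Implicit Arguments.
Unset Strict Implicit.
Unset Printing Implicit Defensive.

Import GroupScope.

Fixpoint PN (gT : finGroupType) (x0 x1 : gT) (n : nat) : gT :=
  match n with
  | 0 => x0
  | 1 => x1
  | 2 => x1 ^+ 2
  | ((m.+1).+1 as p).+1 => PN x0 x1 m * (PN x0 x1 p) ^+ 2
  end.

Definition is_LPN (gT : finGroupType) (x0 x1 : gT) (k : nat) : Prop :=
  [/\ (1 <= k)%N,
      forall n, PN x0 x1 (n + k) = PN x0 x1 n
    & forall j, (1 <= j)%N ->
        (forall n, PN x0 x1 (n + j) = PN x0 x1 n) -> (k <= j)%N].

(* [x ^ y] is the conjugate [y^-1 * x * y]. *)
Definition Q8_standard_generators (gT : finGroupType) (G : {group gT})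
    (x y : gT) : Prop :=
  [/\ <<[set x; y]>> = G :> {set gT},
      x ^+ 4 = 1, y ^+ 2 = x ^+ 2 & x ^ y = x^-1].

(* The relations above are those of the presentation of ['Q_8], so a pair
   satisfying [Q8_standard_generators] in a copy of ['Q_8] is the image of the
   presentation's generators under an isomorphism. *)
Lemma Q8_presentation :
  'Q_8 \isog Grp (x : y : x ^+ 4, y ^+ 2 = x ^+ 2, x ^ y = x^-1).
Proof. exact: (@Grp_quaternion 3). Qed.

(* Main.v *)
(* The orbit runs x, y, x^2, x, y^3, e and then returns to x, y, x^2.  It takes
   the value e only once in these six steps because x^2 <> e: otherwise x and y
   would commute, whereas Q_8 is not abelian. *)
Require Import Defs.
From HB Require Import structures.
From mathcomp Require Import all_boot all_fingroup all_solvable.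

Set Implicit Arguments.
Unset Strict Implicit.
Unset Printing Implicit Defensive.

Import GroupScope.

Lemma PN_rec (gT : finGroupType) (x0 x1 : gT) n :
  PN x0 x1 n.+3 = PN x0 x1 n * PN x0 x1 n.+2 ^+ 2.
Proof. by []. Qed.

(** The recurrence has order three, so a window of three consecutive values determines all later
    ones; the induction carries such a window. The value at index 2 is an initial value, hence the
    third condition. *)
Lemma PN_periodic (gT : finGroupType) (x0 x1 : gT) k :
  PN x0 x1 k = x0 -> PN x0 x1 k.+1 = x1 -> PN x0 x1 k.+2 = x1 ^+ 2 ->
  forall n, PN x0 x1 (n + k) = PN x0 x1 n.
Proof.
move=> Ek Ek1 Ek2 n.
suff [] : [/\ PN x0 x1 (n + k) = PN x0 x1 n,
  PN x0 x1 (n + k).+1 = PN x0 x1 n.+1 & PN x0 x1 (n + k).+2 = PN x0 x1 n.+2]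
  by [].
by elim: n => // n [IH0 IH1 IH2]; rewrite addSn !PN_rec IH0 IH1 IH2.
Qed.

(** The relations alone also hold for generators of the Klein four-group, where [x ^+ 2 = 1]; the
    isomorphism with ['Q_8] excludes this. *)
Lemma Q8_sqr_neq1 (gT : finGroupType) (G : {group gT}) (x y : gT) :
  G \isog 'Q_8 -> Q8_standard_generators G x y -> x ^+ 2 != 1.
Proof.
move=> isoG [genG _ _ xy]; apply/eqP => x2.
have xV : x^-1 = x by apply: (mulgI x); rewrite mulgV -x2.
have cxy : commute x y by apply/commgP/conjg_fixP; rewrite xy xV.
have cG : abelian G.
  rewrite -genG abelian_gen; apply/centsP => u + v.
  by rewrite !inE => /orP[]/eqP-> /orP[]/eqP->.
(* Here [u] has order 4 and [v] inverts it, which in an abelian group would force [u ^+ 2 = 1]. *)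
have [[u v] [_ Gu ou /setDP[Gv _]] [_ _ uv]] :=
  @generators_quaternion _ G 3 isT isoG.
have u2 : u ^+ 2 = 1.
  have uv1 : u ^ v = u by apply/conjg_fixP/commgP/(centsP cG).
  by rewrite expgS expg1 -{1}uv1 uv mulVg.
by have := order_dvdn u 2; rewrite u2 eqxx ou.
Qed.

Theorem theorem11 (gT : finGroupType) (G : {group gT}) (x y : gT)
    (isoG : G \isog 'Q_8) (genG : Q8_standard_generators G x y) :
  is_LPN x y 6.
Proof.
have x2_neq1 := Q8_sqr_neq1 isoG genG.
case: genG => _ x4 y2 _.
have s2 : PN x y 2 = x ^+ 2 by rewrite /= y2.
have s3 : PN x y 3 = x by rewrite PN_rec s2 -expgM x4 mulg1.
have s4 : PN x y 4 = y ^+ 3 by rewrite PN_rec s3 -y2 -expgS.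
(* The term is [x ^+ 2 * y ^+ 6], and [y ^+ 6 = (y ^+ 2) ^+ 3 = x ^+ 6], so it equals [x ^+ 8]. *)
have s5 : PN x y 5 = 1.
  by rewrite PN_rec s2 s4 -expgM (expgM y 2 3) y2 -expgM -expgD (expgM x 4 2) x4
    expg1n.
have s6 : PN x y 6 = x by rewrite PN_rec s3 s5 expg1n mulg1.
have s7 : PN x y 7 = y.
  by rewrite PN_rec s4 s6 -y2 -expgD (expgD y 1 4) (expgM y 2 2) y2 -expgM x4 mulg1.
have s8 : PN x y 8 = x ^+ 2 by rewrite PN_rec s5 s7 mul1g.
have per6 : forall n, PN x y (n + 6) = PN x y n.
  by apply: PN_periodic; rewrite ?s6 ?s7 ?s8 ?y2.
split=> // j j_gt0 perj; rewrite leqNgt; apply/negP => j_lt6.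
(* A period [j < 6] would carry the identity at index 5 to one of the indices 6 to 10, whose values
   [x], [y], [x ^+ 2], [x], [y ^+ 3] are all nontrivial. *)
have: PN x y (5 + j) = 1 by rewrite perj.
have x_neq1 : x != 1 by apply: contraNneq x2_neq1 => ->; rewrite expg1n.
have y_neq1 : y != 1 by apply: contraNneq x2_neq1 => y1; rewrite -y2 y1 expg1n.
have y3_neq1 : y ^+ 3 != 1.
  apply: contraNneq y_neq1 => y3.
  (* If [y ^+ 3 = 1], then [y = y ^+ 4 = x ^+ 4 = 1]. *)
  by rewrite -[y]mulg1 -{}[in X in _ * X]y3 -expgS (expgM y 2 2) y2 -expgM x4.
move/eqP; apply/negP.
case: j j_gt0 j_lt6 {perj} => [|[|[|[|[|[|j]]]]]] // _ _.
- by rewrite s6.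
- by rewrite s7.
- by rewrite s8.
- by rewrite (per6 3) s3.
- by rewrite (per6 4) s4.
Qed.
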